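(* Let $\mathbf{e}=(e_1,\dots,e_{q_1})$ and $\mathbf{f}=(f_1,\dots,f_{q_2})$ be two finite sequences of positive integers. The sequence $\mathcal{Q}_{(\mathbf{e},\mathbf{f})}$ can be written in a unique way in the form $$\mathcal{Q}_{(\mathbf{e},\mathbf{f})}(n)=C^n(\gamma_1)_n^{m_1}\cdots(\gamma_t)_n^{m_t},\qquad n\geq 0,$$ where $C$ is a positive constant, $0<\gamma_1<\dots<\gamma_t\leq 1$ are rational numbers and $m_1,\dots,m_t\in\mathbb{Z}\setminus\{0\}$. The jumps of $\Delta_{(\mathbf{e},\mathbf{f})}$ on $[0,1]$ occur exactly at the abscissas $\gamma_1,\dots,\gamma_t$, the amplitude (positive or negative) of the jump at $\gamma_i$ being $m_i$.
   Context: $\mathcal{Q}_{(\mathbf{e},\mathbf{f})}(n)=\frac{(e_1n)!\cdots(e_{q_1}n)!}{(f_1n)!\cdots(f_{q_2}n)!}$ for $n\ge0$; $\Delta_{(\mathbf{e},\mathbf{f})}(x)=\sum_{i=1}^{q_1}\lfloor e_ix\rfloor-\sum_{j=1}^{q_2}\lfloor f_jx\rfloor$ for $x\in\mathbb{R}$. Pochhammer symbol: $(x)_0=1$, $(x)_n=x(x+1)\cdots(x+n-1)$ for $n\ge1$. The amplitude of the jump of $\Delta_{(\mathbf{e},\mathbf{f})}$ at $\gamma$ is $\Delta_{(\mathbf{e},\mathbf{f})}(\gamma)-\lim_{x\to\gamma^-}\Delta_{(\mathbf{e},\mathbf{f})}(x)$. *)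

(* Defs.v *)
From HB Require Import structures.
From mathcomp Require Import all_boot all_order all_algebra.
From mathcomp Require Import all_classical all_reals all_analysis.

Set Implicit Arguments.
Unset Strict Implicit.
Unset Printing Implicit Defensive.

Import Order.TTheory GRing.Theory Num.Theory.
Import numFieldNormedType.Exports.

Local Open Scope classical_set_scope.
Local Open Scope ring_scope.

Definition pochhammer (R : pzRingType) (x : R) (n : nat) : R :=
  \prod_(i < n) (x + i%:R).

Definition factorial_ratio (F : fieldType) (e f : seq nat) (n : nat) : F :=
  (\prod_(k <- e) ((k * n)`!)%:R) / (\prod_(k <- f) ((k * n)`!)%:R).

Definition Delta (R : realType) (e f : seq nat) (x : R) : R :=
  \sum_(k <- e) (Num.floor (k%:R * x))%:~R
  - \sum_(k <- f) (Num.floor (k%:R * x))%:~R.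

(* [s] lists the pairs (gamma_i, m_i) by increasing gamma_i; [s] may be empty
   (t = 0).  Since every gamma_i is positive, so are its Pochhammer symbols,
   and the integer power [^] is never applied to 0. *)
Definition is_pochhammer_form (R : realType) (e f : seq nat)
    (C : R) (s : seq (rat * int)) : Prop :=
  [/\ 0 < C,
      sorted <%R [seq p.1 | p <- s],
      (forall p, p \in s -> [/\ 0 < p.1, p.1 <= 1 & p.2 != 0])
    & forall n : nat,
        factorial_ratio R e f n =
        C ^+ n * \prod_(p <- s) (pochhammer (ratr p.1 : R) n) ^ p.2].

(* The jumps on [A] are those of the restriction of [g] to [A], whence the
   relative neighbourhoods of [x]: on `[0, 1], the behaviour of [g] to the left
   of 0 is irrelevant.  ([Delta e f], seen on the whole line, jumps at 0 by
   size e - size f.) *)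
Definition jumps_on (R : realType) (g : R -> R) (A : set R) (x : R) : Prop :=
  A x /\ ~ (g y @[y --> within A (nbhs x)] --> g x).

(* [lim] is only meaningful when the left limit exists. *)
Definition jump_amplitude (R : realType) (g : R -> R) (c : R) : R :=
  g c - lim (g y @[y --> c^'-]).

(* Main.v *)
Require Import Defs.
From HB Require Import structures.
From mathcomp Require Import all_boot all_order all_algebra.
From mathcomp Require Import all_classical all_reals all_analysis.
From mathcomp Require Import ring.

Set Implicit Arguments.
Unset Strict Implicit.
Unset Printing Implicit Defensive.

Import Order.TTheory GRing.Theory Num.Theory.
Import numFieldNormedType.Exports.

Local Open Scope classical_set_scope.
Local Open Scope ring_scope.

(** Why the theorem holds.

    For k > 0, sorting the factors of (k (n + 1))! / (k n)! by their residue
    gives (k n)! = (k^k)^n (1/k)_n (2/k)_n ... (k/k)_n ([fact_fractions]).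
    Multiplying over e and dividing over f writes the factorial ratio as
    C^n times a product of Pochhammer symbols with exponents 1 and -1, in which
    the same fraction may occur many times and cancel against itself
    ([factorial_ratio_unreduced]).  Adding up, for each fraction g, the
    exponents it carries ([exponent_at]), and dropping the g whose total is 0,
    produces a form as required ([collect], [pochhammer_prod_collect]).

    Uniqueness: dividing two forms of the same sequence gives
    D^n \prod (g)_n^m = 1 for all n.  The quotient of two consecutive terms
    says that the rational function D \prod (X + g)^m takes the value 1 at
    every natural number, so it is identically 1; having neither zero nor
    pole, it has total exponent 0 at every g, and then D = 1
    ([trivial_pochhammer_form]).  As repeated g are allowed here, every form
    can be compared directly with the unreduced product
    ([pochhammer_form_exponent_at]): its constant is C, and its entries are the
    pairs (g, m) where m <> 0 is the total exponent of g.

    Jumps: y |-> floor (k y) is a right-continuous step function which jumps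
    by 1 exactly at the points c with k c an integer.  Hence Delta is
    right-continuous, and its jump at c is the number of k in e minus the
    number of k in f with k c an integer ([jump], [Delta_cvg_left]).  For
    0 < c <= 1, k c is an integer exactly when c is one of 1/k, ..., k/k, each
    of which occurs once, so the jump at g is the total exponent of g
    ([exponent_at_unreduced]). *)

(** * Total exponents of products of powers *)

Definition exponent_at (s : seq (rat * int)) (g : rat) : int :=
  \sum_(p <- s | p.1 == g) p.2.

Definition pochhammer_prod (R : numFieldType) (s : seq (rat * int)) (n : nat) : R :=
  \prod_(p <- s) (pochhammer (ratr p.1 : R) n) ^ p.2.

Lemma exponent_at_cat s t g :
  exponent_at (s ++ t) g = exponent_at s g + exponent_at t g.
Proof. by rewrite /exponent_at big_cat. Qed.

Lemma exponent_at_opp s g :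
  exponent_at [seq (p.1, - p.2) | p <- s] g = - exponent_at s g.
Proof. by rewrite /exponent_at big_map sumrN. Qed.

Lemma exponent_at_notin s g : g \notin unzip1 s -> exponent_at s g = 0.
Proof.
move=> gs; rewrite /exponent_at big1_seq // => p /andP[/eqP pg ps].
by move: gs; rewrite -pg map_f.
Qed.

(** Bases must not vanish, as x ^ (a + b) = x ^ a * x ^ b fails for x = 0 and
    exponents of opposite signs. *)
Lemma prod_exponent_at (K : fieldType) (F : rat -> K) s :
    (forall p, p \in s -> F p.1 != 0) ->
  \prod_(p <- s) F p.1 ^ p.2 =
  \prod_(g <- undup (unzip1 s)) F g ^ exponent_at s g.
Proof.
move=> F0; transitivity (\prod_(g <- undup (unzip1 s))
    \prod_(p <- s | p.1 == g) F g ^ p.2); last first.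
  apply: eq_big_seq => g; rewrite mem_undup => /mapP[p ps ->].
  apply/esym/(big_morph (fun m => F p.1 ^ m)) => [a b|]; last exact: expr0z.
  exact/expfzDr/F0.
rewrite (exchange_big_dep predT) //=; apply: eq_big_seq => p ps.
rewrite -big_filter filter_undup; under eq_filter do rewrite eq_sym.
rewrite -filter_undup filter_pred1_uniq ?undup_uniq ?mem_undup ?map_f//.
by rewrite big_seq1.
Qed.

(** * A product of Pochhammer symbols determines its exponents *)

Lemma pochhammerS (R : pzRingType) (x : R) n :
  pochhammer x n.+1 = pochhammer x n * (x + n%:R).
Proof. by rewrite /pochhammer big_ord_recr. Qed.

Lemma pochhammer_gt0 (R : numDomainType) (x : R) n : 0 < x -> 0 < pochhammer x n.
Proof. by move=> x0; apply: prodr_gt0 => i _; rewrite ltr_wpDr. Qed.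

Lemma pochhammer_prodS (R : numFieldType) s n :
  pochhammer_prod R s n.+1 =
  pochhammer_prod R s n * \prod_(p <- s) (ratr p.1 + n%:R) ^ p.2.
Proof.
rewrite /pochhammer_prod -big_split; apply: eq_bigr => p _ /=.
by rewrite pochhammerS expfzMl.
Qed.

Lemma pochhammer_prod_neq0 (R : numFieldType) (s : seq (rat * int)) n :
  (forall p, p \in s -> 0 < p.1) -> pochhammer_prod R s n != 0.
Proof.
move=> s0; rewrite /pochhammer_prod prodf_seq_neq0; apply/allP => p ps /=.
by rewrite expfz_neq0 // gt_eqF // pochhammer_gt0 // ltr0q s0.
Qed.

Lemma poly_eq_on_nat (K : numFieldType) (P Q : {poly K}) :
  (forall n : nat, P.[n%:R] = Q.[n%:R]) -> P = Q.
Proof.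
move=> PQ; apply/eqP; rewrite -subr_eq0; apply/eqP.
apply: (@roots_geq_poly_eq0 _ _ [seq i%:R | i <- iota 0 (size (P - Q))]).
- by apply/allP => _ /mapP[n _ ->]; rewrite /root hornerD hornerN PQ subrr.
- by rewrite map_inj_uniq ?iota_uniq // => i j /eqP; rewrite eqr_nat => /eqP.
- by rewrite size_map size_iota.
Qed.

(** A rational function with value 1 at all naturals is constant, while a base
    with nonzero exponent makes its negative a zero or a pole. *)
Lemma rational_function_trivial (R : numFieldType) (D : R) (G : seq rat)
    (a : rat -> int) :
    D != 0 -> (forall g, g \in G -> 0 < g) ->
    (forall n : nat, D * \prod_(g <- G) (ratr g + n%:R) ^ a g = 1) ->
  forall g, g \in G -> a g = 0.
Proof.
move=> D0 G0 H.
(* P gathers the factors with nonnegative exponent and Q inverts the others, so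
   the hypothesis is P = Q at the naturals, without denominators. *)
pose F (g : rat) : {poly R} := ('X + (ratr g)%:P) ^+ `|a g|%N.
pose P := D *: \prod_(g <- G | 0 <= a g) F g.
pose Q := \prod_(g <- G | ~~ (0 <= a g)) F g.
have FE g x : (F g).[x] = (ratr g + x) ^+ `|a g|%N.
  by rewrite /F horner_exp hornerD hornerX hornerC addrC.
have PQ : P = Q.
  apply: poly_eq_on_nat => n; rewrite /P /Q hornerZ !horner_prod.
  move: (H n); rewrite (bigID (fun g => 0 <= a g)) /=.
  have -> : \prod_(g <- G | 0 <= a g) (ratr g + n%:R : R) ^ a g =
      \prod_(g <- G | 0 <= a g) (F g).[n%:R].
    by apply: eq_bigr => g; rewrite FE => /gez0_abs {1}<-.
  have -> : \prod_(g <- G | ~~ (0 <= a g)) (ratr g + n%:R : R) ^ a g =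
      (\prod_(g <- G | ~~ (0 <= a g)) (F g).[n%:R])^-1.
    rewrite -prodfV; apply: eq_bigr => g; rewrite FE -ltNge => /ltz0_abs agE.
    by rewrite [_ ^+ _]exprnP agE invr_expz opprK.
  set A := \prod_(g <- G | 0 <= a g) _; set B := \prod_(g <- G | _) _ => E.
  have B0 : B != 0.
    apply: contra_eq_neq E => ->; rewrite invr0 !mulr0.
    by rewrite eq_sym oner_neq0.
  by rewrite -[RHS]mul1r -E mulrA divfK.
(* -g is a root of P, or of Q, only through the factor of g itself; as that
   factor lies on one side only, P = Q forces its exponent to vanish. *)
have rootF (b : pred rat) g : g \in G ->
    ((\prod_(h <- G | b h) F h).[- ratr g] == 0) = b g && (a g != 0).
  move=> gG; rewrite horner_prod prodf_seq_eq0; apply/hasP/andP => [[h hG]|].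
    rewrite FE expf_eq0 absz_gt0 subr_eq0 => /and3P[bh ah].
    by rewrite (inj_eq (fmorph_inj _)) => /eqP <-.
  by case=> bg ag; exists g; rewrite // bg FE subrr expf_eq0 absz_gt0 ag eqxx.
move=> g gG; have := congr1 (fun p : {poly R} => p.[- ratr g] == 0) PQ.
rewrite /= hornerZ mulf_eq0 (negPf D0) /= !rootF //.
by case: (0 <= a g) => //=; case: eqVneq.
Qed.

(** Consecutive terms have quotient D \prod (g + n) ^ m, to which
    [rational_function_trivial] applies once equal bases are gathered. *)
Lemma trivial_pochhammer_form (R : numFieldType) (D : R) (s : seq (rat * int)) :
    (forall p, p \in s -> 0 < p.1) ->
    (forall n, D ^+ n * pochhammer_prod R s n = 1) ->
  D = 1 /\ forall g, exponent_at s g = 0.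
Proof.
move=> s0 H.
have step n : D * \prod_(g <- undup (unzip1 s))
    (ratr g + n%:R) ^ exponent_at s g = 1.
  rewrite -(prod_exponent_at (F := fun g => ratr g + n%:R)); last first.
    by move=> p ps; rewrite gt_eqF // ltr_wpDr // ltr0q s0.
  by have := H n.+1; rewrite exprSr pochhammer_prodS mulrACA H mul1r.
have a0 g : exponent_at s g = 0.
  have [gs|/exponent_at_notin//] := boolP (g \in unzip1 s).
  apply: (rational_function_trivial (D := D) (G := undup (unzip1 s))) => //.
  - by apply: contra_eq_neq (step 0) => ->; rewrite mul0r eq_sym oner_neq0.
  - by move=> h; rewrite mem_undup => /mapP[p ps ->]; exact: s0.
  - by rewrite mem_undup.
split=> //; rewrite -(step 0) big1 ?mulr1 // => g _.
by rewrite a0 expr0z.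
Qed.

(** The quotient of the two sides is again a product of this kind: the exponents
    of [t] are negated and appended to those of [s]. *)
Lemma pochhammer_form_inj (R : numFieldType) (C D : R) (s t : seq (rat * int)) :
    0 < D -> (forall p, p \in s -> 0 < p.1) -> (forall p, p \in t -> 0 < p.1) ->
    (forall n, C ^+ n * pochhammer_prod R s n = D ^+ n * pochhammer_prod R t n) ->
  C = D /\ exponent_at s =1 exponent_at t.
Proof.
move=> D0 s0 t0 H; pose u := s ++ [seq (p.1, - p.2) | p <- t].
have u0 p : p \in u -> 0 < p.1.
  by rewrite mem_cat => /orP[/s0//|/mapP[q /t0 q0 ->]].
have [] := @trivial_pochhammer_form R (C / D) u u0.
  move=> n; have -> : pochhammer_prod R u n =
      pochhammer_prod R s n / pochhammer_prod R t n.
    rewrite /pochhammer_prod big_cat big_map /= -prodfV; congr (_ * _).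
    by apply: eq_bigr => p _; rewrite invr_expz.
  rewrite expr_div_n mulrACA H -invfM mulfV //.
  by rewrite mulf_neq0 ?expf_neq0 ?pochhammer_prod_neq0 // gt_eqF.
move=> CD u00; split; first by apply: divr1_eq.
move=> g; apply/eqP; rewrite -subr_eq0 -exponent_at_opp -exponent_at_cat.
by rewrite u00.
Qed.

(** * Reduced forms *)

Lemma exponent_at_mem s p :
  uniq (unzip1 s) -> p \in s -> exponent_at s p.1 = p.2.
Proof.
rewrite /exponent_at; elim: s => // q s IHs /= /andP[qs us].
rewrite inE big_cons => /orP[/eqP ->|ps].
  by rewrite eqxx -[X in _ + X]/(exponent_at s q.1) exponent_at_notin // addr0.
have /negPf -> : q.1 != p.1; last exact: IHs.
by apply: contraNneq qs => ->; exact: map_f.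
Qed.

(** A reduced list is thus determined, as a set, by its total exponents; being
    sorted, it is then determined as a list. *)
Lemma mem_exponent_at s p :
    uniq (unzip1 s) -> (forall q, q \in s -> q.2 != 0) ->
  (p \in s) = (exponent_at s p.1 == p.2) && (p.2 != 0).
Proof.
move=> us s0; apply/idP/andP => [ps|[/eqP eps p0]].
  by rewrite exponent_at_mem // eqxx s0.
have : p.1 \in unzip1 s.
  by apply: contraNT p0 => /exponent_at_notin; rewrite eps => ->.
case/mapP => q qs pq; suff -> : p = q by [].
by rewrite [p]surjective_pairing -eps pq exponent_at_mem // -surjective_pairing.
Qed.

Definition collect (s : seq (rat * int)) : seq (rat * int) :=
  [seq (g, exponent_at s g) | g <- sort <=%R (undup (unzip1 s))
                            & exponent_at s g != 0].

Lemma sorted_collect s : sorted <%R [seq p.1 | p <- collect s].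
Proof.
rewrite -map_comp map_id sorted_filter //; first exact: lt_trans.
by rewrite sort_lt_sorted undup_uniq.
Qed.

Lemma mem_collect s p : p \in collect s -> p.1 \in unzip1 s /\ p.2 != 0.
Proof.
by case/mapP => g; rewrite mem_filter mem_sort mem_undup => /andP[? ?] ->.
Qed.

(** Positivity of the bases keeps the Pochhammer symbols away from 0, which
    [prod_exponent_at] requires. *)
Lemma pochhammer_prod_collect (R : numFieldType) (s : seq (rat * int)) n :
  (forall p, p \in s -> 0 < p.1) ->
  pochhammer_prod R (collect s) n = pochhammer_prod R s n.
Proof.
move=> s0; rewrite /pochhammer_prod.
rewrite [RHS](prod_exponent_at (F := fun g => pochhammer (ratr g : R) n)); last first.
  by move=> p ps; rewrite gt_eqF // pochhammer_gt0 // ltr0q s0.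
rewrite /collect big_map big_filter /=.
rewrite (perm_big (undup (unzip1 s))) /=; last exact: permEl (perm_sort _ _).
rewrite big_mkcond; apply: eq_bigr => g _.
by case: eqP => //= ->; rewrite expr0z.
Qed.

(** * The factorial ratio as a product of Pochhammer symbols *)

Definition fractions (k : nat) : seq rat :=
  [seq j.+1%:R / k%:R | j <- index_iota 0 k].

Lemma fact_addn (m k : nat) :
  (m + k)`! = (m`! * \prod_(0 <= j < k) (m + j.+1))%N.
Proof.
elim: k => [|k IHk]; first by rewrite addn0 big_geq // muln1.
by rewrite addnS factS IHk big_nat_recr //= addnS mulnCA [(_.+1 * _)%N]mulnC.
Qed.

(** Passing from n to n + 1 multiplies the left side by the k factors
    k n + j + 1 = k ((j + 1) / k + n), for j < k. *)
Lemma fact_fractions (K : numFieldType) (k n : nat) : (0 < k)%N ->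
  ((k * n)`!)%:R =
  (k%:R ^+ k) ^+ n * \prod_(g <- fractions k) pochhammer (ratr g : K) n.
Proof.
move=> k0; elim: n => [|n IHn].
  by rewrite muln0 expr0 mul1r big1 // => g _; rewrite /pochhammer big_ord0.
under [in RHS]eq_bigr do rewrite pochhammerS.
rewrite mulnS addnC fact_addn natrM IHn big_split exprSr mulrACA; congr (_ * _).
rewrite natr_prod /fractions big_map -[in RHS](subn0 k) -prodr_const_nat subn0.
rewrite -big_split; apply: eq_bigr => j _ /=.
have k0' : k%:R != 0 :> K by rewrite pnatr_eq0 -lt0n.
by rewrite fmorph_div !rmorph_nat mulrDr mulrCA mulfV // mulr1 natrD natrM addrC.
Qed.

(** Stated for an arbitrary real x, so that it also shows that a point of ]0, 1]
    where some k x is an integer is rational. *)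
Lemma mem_fractions (R : realType) (k : nat) (x : R) : (0 < k)%N ->
  (x \in [seq ratr g | g <- fractions k]) =
  [&& 0 < x, x <= 1 & k%:R * x \is a Num.int].
Proof.
move=> k0; have k0' : 0 < k%:R :> R by rewrite ltr0n.
have k0N : k%:R != 0 :> R by rewrite gt_eqF.
rewrite -map_comp; apply/mapP/and3P => [[j]|[x0 x1 /intrP[z kx]]].
  rewrite mem_index_iota => /andP[_ jk] -> /=.
  rewrite fmorph_div !rmorph_nat divr_gt0 ?ltr0n // ler_pdivrMr // mul1r ler_nat.
  by rewrite mulrC divfK // natr_int.
have z0 : 0 < z by rewrite -(ltr0z R) -kx mulr_gt0.
have zk : z <= k by rewrite -(ler_int R) -kx ger_pMr.
case: z z0 zk kx => // -[//|j] _ jk kx; exists j.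
  by rewrite mem_index_iota.
by rewrite /= fmorph_div !rmorph_nat; apply: (mulfI k0N); rewrite kx mulrC divfK.
Qed.

Lemma uniq_fractions k : uniq (fractions k).
Proof.
rewrite map_inj_in_uniq ?iota_uniq // => i j.
rewrite !mem_index_iota => /andP[_ ik] _ /divIf E.
have /E/eqP : k%:R != 0 :> rat by rewrite pnatr_eq0 -lt0n (leq_trans _ ik).
by rewrite eqr_nat => /eqP[].
Qed.

Definition unreduced (e f : seq nat) : seq (rat * int) :=
  [seq (g, 1) | k <- e, g <- fractions k]
  ++ [seq (g, - 1) | k <- f, g <- fractions k].

Lemma unreduced_range (e f : seq nat) p :
    (forall k, k \in e -> (0 < k)%N) -> (forall k, k \in f -> (0 < k)%N) ->
  p \in unreduced e f -> 0 < p.1 /\ p.1 <= 1.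
Proof.
have aux k g : (0 < k)%N -> g \in fractions k -> 0 < g /\ g <= 1.
  move=> k0 /mapP[j]; rewrite mem_index_iota => /andP[_ jk] ->.
  by rewrite divr_gt0 ?ltr0n // ler_pdivrMr ?ltr0n // mul1r ler_nat.
move=> he hf; rewrite mem_cat.
by case/orP => /allpairsPdep[k [g [kl gk ->]]]; apply: (aux k g) => //; auto.
Qed.

Definition geometric_base (R : numFieldType) (e f : seq nat) : R :=
  (\prod_(k <- e) k%:R ^+ k) / (\prod_(k <- f) k%:R ^+ k).

Lemma geometric_base_gt0 (R : numFieldType) (e f : seq nat) :
    (forall k, k \in e -> (0 < k)%N) -> (forall k, k \in f -> (0 < k)%N) ->
  0 < geometric_base R e f.
Proof.
have aux (l : seq nat) : (forall k, k \in l -> (0 < k)%N) ->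
    0 < \prod_(k <- l) (k%:R : R) ^+ k.
  move=> hl; rewrite big_seq; apply: prodr_gt0 => k /hl k0.
  by rewrite exprn_gt0 // ltr0n.
by move=> he hf; rewrite divr_gt0 ?aux.
Qed.

Lemma factorial_ratio_unreduced (R : numFieldType) (e f : seq nat) n :
    (forall k, k \in e -> (0 < k)%N) -> (forall k, k \in f -> (0 < k)%N) ->
  factorial_ratio R e f n =
  geometric_base R e f ^+ n * pochhammer_prod R (unreduced e f) n.
Proof.
have aux (l : seq nat) : (forall k, k \in l -> (0 < k)%N) ->
    \prod_(k <- l) ((k * n)`!)%:R = (\prod_(k <- l) k%:R ^+ k) ^+ n *
      \prod_(k <- l) \prod_(g <- fractions k) pochhammer (ratr g : R) n.
  move=> hl; rewrite -prodrXl -big_split; apply: eq_big_seq => k /hl.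
  exact: fact_fractions.
move=> he hf; rewrite /factorial_ratio !aux // /geometric_base /pochhammer_prod.
rewrite big_cat !big_allpairs_dep expr_div_n invfM -!mulrA; congr (_ * _).
rewrite mulrCA; congr (_ * (_ * _)).
rewrite -prodfV; apply: eq_bigr => k _; rewrite -prodfV.
by apply: eq_bigr => g _; rewrite exprN1.
Qed.

(** * The jumps of Delta *)

Definition jump (R : realType) (e f : seq nat) (x : R) : int :=
  (count (fun k => k%:R * x \is a Num.int) e)%:Z
  - (count (fun k => k%:R * x \is a Num.int) f)%:Z.

(** The fraction g occurs once among 1/k, ..., k/k if k g is an integer, and not
    at all otherwise. *)
Lemma exponent_at_unreduced (R : realType) (e f : seq nat) g :
    (forall k, k \in e -> (0 < k)%N) -> (forall k, k \in f -> (0 < k)%N) ->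
    0 < g -> g <= 1 ->
  exponent_at (unreduced e f) g = jump e f (ratr g : R).
Proof.
move=> he hf g0 g1.
have aux (c : int) (l : seq nat) : (forall k, k \in l -> (0 < k)%N) ->
    exponent_at [seq (h, c) | k <- l, h <- fractions k] g =
    c *+ count (fun k => k%:R * (ratr g : R) \is a Num.int) l.
  move=> hl; rewrite /exponent_at big_mkcond big_allpairs_dep /=.
  rewrite -iter_addr_0 -big_const_seq [RHS]big_mkcond; apply: eq_big_seq => k kl.
  rewrite -big_mkcond /=.
  have := mem_fractions (ratr g : R) (hl k kl).
  rewrite (mem_map (fmorph_inj _)) ltr0q g0 -(rmorph1 (@ratr R)) ler_rat g1 /= => <-.
  case: ifP => [gk|gk].
    by rewrite -big_filter filter_pred1_uniq ?uniq_fractions // big_seq1.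
  by rewrite big1_seq // => h /andP[/eqP ->]; rewrite gk.
by rewrite exponent_at_cat !aux // mulNrn /jump -!natz.
Qed.

Lemma jump_neq0 (R : realType) (e f : seq nat) (x : R) :
    (forall k, k \in e -> (0 < k)%N) -> (forall k, k \in f -> (0 < k)%N) ->
    0 < x -> x <= 1 -> jump e f x != 0 ->
  exists g, x = ratr g.
Proof.
move=> he hf x0 x1.
have aux (l : seq nat) : (forall k, k \in l -> (0 < k)%N) ->
    count (fun k => k%:R * x \is a Num.int) l != 0%N -> exists g, x = ratr g.
  move=> hl; rewrite -lt0n -has_count => /hasP[k kl kx].
  have := mem_fractions x (hl k kl); rewrite x0 x1 kx /=.
  by move=> /mapP[g _ ->]; exists g.
rewrite /jump; set m := count _ e; set n := count _ f.
have [->|/(aux _ he)//] := eqVneq m 0%N.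
by have [->|/(aux _ hf)//] := eqVneq n 0%N; rewrite subrr eqxx.
Qed.

(** Just left of c, floor (k y) is constantly ceil (k c) - 1, which is
    floor (k c), minus 1 if k c is an integer. *)
Lemma near_left_sum_floor (R : realType) (l : seq nat) (c : R) :
    (forall k, k \in l -> (0 < k)%N) ->
  \forall y \near c^'-, \sum_(k <- l) (Num.floor (k%:R * y))%:~R =
    \sum_(k <- l) (Num.floor (k%:R * c))%:~R
    - (count (fun k => k%:R * c \is a Num.int) l)%:R :> R.
Proof.
elim: l => [|k l IHl] hl.
  by apply: nearW => y; rewrite !big_nil subr0.
have k0 : 0 < k%:R :> R by rewrite ltr0n hl ?mem_head.
have kc : k%:R^-1 * (Num.ceil (k%:R * c) - 1)%:~R < c.
  by rewrite ltr_pdivrMl // -ceil_gt_int ltrBlDr ltrDl.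
have {}IHl := IHl (fun j jl => hl j (mem_behead (s := k :: l) jl)).
near=> y; rewrite !big_cons /= (near IHl y) //.
have -> : Num.floor (k%:R * y) = Num.ceil (k%:R * c) - 1.
  apply: floor_def; rewrite subrK; apply/andP; split.
    rewrite -ler_pdivrMl //; near: y; exact: nbhs_left_ge.
  by apply: lt_le_trans _ (ceil_ge _); rewrite ltr_pM2l.
rewrite ceil_floor; case: (_ \is a Num.int) => /=.
  by rewrite addr0 rmorphB /= natrD; ring.
by rewrite addrK add0n addrA.
Unshelve. all: by end_near. Qed.

Lemma near_right_sum_floor (R : realType) (l : seq nat) (c : R) :
    (forall k, k \in l -> (0 < k)%N) ->
  \forall y \near c^'+, \sum_(k <- l) (Num.floor (k%:R * y))%:~R =
    \sum_(k <- l) (Num.floor (k%:R * c))%:~R :> R.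
Proof.
elim: l => [|k l IHl] hl.
  by apply: nearW => y; rewrite !big_nil.
have k0 : 0 < k%:R :> R by rewrite ltr0n hl ?mem_head.
have kc : c < k%:R^-1 * (Num.floor (k%:R * c) + 1)%:~R.
  by rewrite ltr_pdivlMl // floorD1_gt.
have {}IHl := IHl (fun j jl => hl j (mem_behead (s := k :: l) jl)).
near=> y; rewrite !big_cons /= (near IHl y) //; congr (_ + _).
congr (_%:~R); apply: floor_def; apply/andP; split.
  by apply: le_trans (floor_le _) _; rewrite ler_pM2l.
rewrite -ltr_pdivlMl //; near: y; exact: nbhs_right_lt.
Unshelve. all: by end_near. Qed.


Lemma near_left_Delta (R : realType) (e f : seq nat) (c : R) :
    (forall k, k \in e -> (0 < k)%N) -> (forall k, k \in f -> (0 < k)%N) ->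
  \forall y \near c^'-, Delta e f y = Delta e f c - (jump e f c)%:~R.
Proof.
move=> he hf.
apply: filterS2 (near_left_sum_floor c he) (near_left_sum_floor c hf) => y ey fy.
by rewrite /Delta ey fy /jump rmorphB /= -!pmulrn; ring.
Qed.

Lemma near_right_Delta (R : realType) (e f : seq nat) (c : R) :
    (forall k, k \in e -> (0 < k)%N) -> (forall k, k \in f -> (0 < k)%N) ->
  \forall y \near c^'+, Delta e f y = Delta e f c.
Proof.
move=> he hf.
apply: filterS2 (near_right_sum_floor c he) (near_right_sum_floor c hf).
by move=> y ey fy; rewrite /Delta ey fy.
Qed.

Lemma Delta_cvg_left (R : realType) (e f : seq nat) (c : R) :
    (forall k, k \in e -> (0 < k)%N) -> (forall k, k \in f -> (0 < k)%N) ->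
  Delta e f y @[y --> c^'-] --> Delta e f c - (jump e f c)%:~R.
Proof. by move=> he hf; apply: cvg_near_cst; exact: near_left_Delta. Qed.

Lemma jump_amplitude_Delta (R : realType) (e f : seq nat) (c : R) :
    (forall k, k \in e -> (0 < k)%N) -> (forall k, k \in f -> (0 < k)%N) ->
  jump_amplitude (Delta e f) c = (jump e f c)%:~R.
Proof.
move=> he hf; rewrite /jump_amplitude (cvg_lim _ (Delta_cvg_left he hf)) //.
by rewrite subKr.
Qed.

(** At c = 0 only the right-hand side of c lies in [0, 1], where Delta is
    continuous; at any other c of [0, 1] the left-hand side lies in it near c. *)
Lemma jumps_on_Delta (R : realType) (e f : seq nat) (c : R) :
    (forall k, k \in e -> (0 < k)%N) -> (forall k, k \in f -> (0 < k)%N) ->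
  jumps_on (Delta e f) `[0, 1] c <-> [/\ 0 < c, c <= 1 & jump e f c != 0].
Proof.
move=> he hf; rewrite /jumps_on /= in_itv /=; split.
  case=> /andP[c0 c1] njump; apply/and3P; rewrite c1 /=.
  apply/negPn/negP => Hc; apply: njump; apply: cvg_near_cst.
  have L : \forall y \near c, y < c -> Delta e f y = _ :=
    near_left_Delta c he hf.
  have G : \forall y \near c, c < y -> Delta e f y = _ :=
    near_right_Delta c he hf.
  rewrite near_withinE; near=> y; rewrite /= in_itv /= => /andP[y0 y1].
  have [yc|cy|-> //] := ltgtP y c; last by rewrite (near G y).
  move: Hc; rewrite (le_lt_trans y0 yc) /= negbK => /eqP j0.
  by rewrite (near L y) // j0 subr0.
case=> c0 c1 jc; split; first by rewrite c1 ltW.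
move=> Hc; move/negP: jc; apply.
have : Delta e f y @[y --> c^'-] --> Delta e f c.
  apply: cvg_trans Hc; move=> P; rewrite /= => HP.
  have H : \forall y \near c^'-, y \in `[0, 1] -> P (Delta e f y).
    apply: cvg_within; exact: HP.
  suff : \forall y \near c^'-, P (Delta e f y) by [].
  near=> y; apply: (near H y) => //.
  rewrite in_itv /=; apply/andP; split; first by near: y; exact: nbhs_left_ge.
  by apply: le_trans c1; near: y; exact: nbhs_left_le.
move=> /(cvg_unique (@Rhausdorff R) (Delta_cvg_left he hf)) /eqP.
by rewrite -subr_eq0 addrAC subrr sub0r oppr_eq0 intr_eq0.
Unshelve. all: by end_near. Qed.

(** * Pochhammer forms and jumps *)

Lemma is_pochhammer_form_collect (R : realType) (e f : seq nat) :
    (forall k, k \in e -> (0 < k)%N) -> (forall k, k \in f -> (0 < k)%N) ->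
  is_pochhammer_form e f (geometric_base R e f) (collect (unreduced e f)).
Proof.
move=> he hf; split; first exact: geometric_base_gt0.
- exact: sorted_collect.
- by move=> p /mem_collect[/mapP[q /(unreduced_range he hf)[? ?] ->] ?].
- move=> n; rewrite factorial_ratio_unreduced //; congr (_ * _).
  by rewrite -pochhammer_prod_collect // => p /(unreduced_range he hf)[].
Qed.

Lemma pochhammer_form_exponent_at (R : realType) (e f : seq nat) C s :
    (forall k, k \in e -> (0 < k)%N) -> (forall k, k \in f -> (0 < k)%N) ->
    is_pochhammer_form e f (C : R) s ->
  C = geometric_base R e f /\ exponent_at s =1 exponent_at (unreduced e f).
Proof.
move=> he hf [C0 _ s01 H]; apply: pochhammer_form_inj.
- exact: geometric_base_gt0.
- by move=> p /s01[].
- by move=> p /(unreduced_range he hf)[].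
- by move=> n; rewrite -factorial_ratio_unreduced // H.
Qed.

Lemma mem_pochhammer_form (R : realType) (e f : seq nat) (C : R) s p :
    (forall k, k \in e -> (0 < k)%N) -> (forall k, k \in f -> (0 < k)%N) ->
    is_pochhammer_form e f C s ->
  (p \in s) = [&& exponent_at (unreduced e f) p.1 == p.2 & p.2 != 0].
Proof.
move=> he hf Hs; have [_ <-] := pochhammer_form_exponent_at he hf Hs.
case: Hs => _ srt s01 _; apply: mem_exponent_at.
  exact: lt_sorted_uniq.
by move=> q /s01[].
Qed.

(** The bounds on g select one period: [jump e f] is invariant under x |-> x + 1,
    whereas all bases lie in ]0, 1]. *)
Lemma mem_pochhammer_form_jump (R : realType) (e f : seq nat) (C : R) s g m :
    (forall k, k \in e -> (0 < k)%N) -> (forall k, k \in f -> (0 < k)%N) ->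
    is_pochhammer_form e f C s ->
  ((g, m) \in s) =
    [&& 0 < g, g <= 1, jump e f (ratr g : R) == m & m != 0].
Proof.
move=> he hf Hs; have E := mem_pochhammer_form (g, m) he hf Hs.
apply/idP/and4P => [gs|[g0 g1 jm m0]].
  have [_ _ s01 _] := Hs; have /= [g0 g1 m0] := s01 _ gs; split=> //.
  by rewrite -exponent_at_unreduced //; move: gs; rewrite E => /andP[].
by rewrite E /= (exponent_at_unreduced R) // jm.
Qed.

Theorem proposition3 (R : realType) (e f : seq nat)
    (he : forall k, k \in e -> (0 < k)%N)
    (hf : forall k, k \in f -> (0 < k)%N) :
  (exists! d : R * seq (rat * int), is_pochhammer_form e f d.1 d.2)
  /\ (forall (C : R) (s : seq (rat * int)), is_pochhammer_form e f C s ->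
        (forall x : R,
           jumps_on (Delta e f) `[0, 1] x <-> exists2 p, p \in s & x = ratr p.1)
        /\ (forall p, p \in s ->
              cvg (Delta e f y @[y --> (ratr p.1 : R)^'-])
              /\ jump_amplitude (Delta e f) (ratr p.1 : R) = p.2%:~R)).
Proof.
split.
  have H := is_pochhammer_form_collect R he hf.
  exists (geometric_base R e f, collect (unreduced e f)); split=> // -[C s] /= Hs.
  have [<- _] := pochhammer_form_exponent_at he hf Hs; congr (_, _).
  have [_ srt _ _] := Hs; have [_ srt' _ _] := H.
  apply: (@irr_sorted_eq _ (relpre fst <%R)).
  - by move=> ? ? ?; exact: lt_trans.
  - by move=> ?; exact: ltxx.
  - by rewrite -sorted_map.
  - by rewrite -sorted_map.
  - move=> p; rewrite (mem_pochhammer_form _ he hf H).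
    by rewrite (mem_pochhammer_form _ he hf Hs).
move=> C s Hs; have E g m := mem_pochhammer_form_jump g m he hf Hs.
split=> [x|[g m]].
  rewrite jumps_on_Delta //; split=> [[x0 x1 jx]|[[g m]]].
    have [g xg] := jump_neq0 he hf x0 x1 jx; rewrite {}xg in x0 x1 jx *.
    exists (g, jump e f (ratr g : R)) => //.
    rewrite E eqxx jx -(ltr0q R) x0 -(ler_rat R).
    by rewrite rmorph1 x1.
  rewrite E => /and4P[g0 g1 /eqP jm m0] ->; split.
  - by rewrite ltr0q.
  - by rewrite -(rmorph1 (@ratr R)) ler_rat.
  - by rewrite jm.
rewrite E => /and4P[g0 g1 /eqP jm m0] /=; split.
  by apply/cvg_ex; eexists; exact: Delta_cvg_left.
by rewrite jump_amplitude_Delta // jm.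
Qed.
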